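(* 1. $s(r+1,r)\le 6.239/(r+1)$ for all positive integers $r$. 2. $s(r+1,r)\le 4.911/(r+1)$ for all sufficiently large integers $r$.
   Context: Let $r<k$ be positive integers and $X$ a set. A sequence $x\in X^r$ covers a sequence $a\in X^k$ if $x$ is a (not necessarily contiguous) subsequence of $a$, i.e., $x$ is obtained from $a$ by removing $k-r$ entries while keeping the order of the remaining entries. A set $C\subseteq X^r$ covering $X^k$ (i.e., such that every sequence in $X^k$ is covered by at least one sequence in $C$) is called a covering $(k-r)$-insertion code over $X$. Write $[n]=\{0,1,\ldots,n-1\}$. $S(n,k,r)$ denotes the minimum cardinality of a covering $(k-r)$-insertion code $C\subseteq[n]^r$ over $[n]$, and $s(k,r)=\lim_{n\to\infty}S(n,k,r)/n^r$ (this limit exists). *)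

(* Defs.v *)
From HB Require Import structures.
From mathcomp Require Import all_boot all_order all_algebra.

Set Implicit Arguments.
Unset Strict Implicit.
Unset Printing Implicit Defensive.

Definition covers (X : eqType) (k r : nat) (x : r.-tuple X) (a : k.-tuple X) :
  bool := subseq x a.

Definition covering_insertion_code (X : finType) (k r : nat)
    (C : {set r.-tuple X}) : bool :=
  [forall a : k.-tuple X, [exists x in C, covers x a]].

(* [S(n, k, r)]. The default value [setT] of the [arg min] is itself a covering
   code when [r <= k] (lemma [covering_setT]), so this is then the minimum. *)
Definition Scode (n k r : nat) : nat :=
  #|[arg min_(C < [set: r.-tuple 'I_n] | covering_insertion_code k C) #|C| ]|.

Lemma covering_setT (X : finType) (k r : nat) :
  r <= k -> covering_insertion_code k [set: r.-tuple X].
Proof.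
move=> rk; apply/forallP => a; apply/existsP.
have sz : size (take r a) == r by rewrite size_take_min size_tuple (minn_idPl rk).
by exists (Tuple sz); rewrite inE /covers /= take_subseq.
Qed.

Lemma Scode_min (n k r : nat) (C : {set r.-tuple 'I_n}) :
  r <= k -> covering_insertion_code k C -> Scode n k r <= #|C|.
Proof.
move=> rk hC; rewrite /Scode; case: arg_minnP; first exact: covering_setT.
by move=> D _; apply.
Qed.

Lemma Scode_attained (n k r : nat) : r <= k ->
  exists2 C : {set r.-tuple 'I_n},
    covering_insertion_code k C & #|C| = Scode n k r.
Proof.
move=> rk; rewrite /Scode; case: arg_minnP; first exact: covering_setT.
by move=> D hD _; exists D.
Qed.

Lemma Scode_blowup (n N k r q : nat) : r <= k -> N <= q * n ->
  Scode N k r <= q ^ r * Scode n k r.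
Proof.
move=> rk Nqn; have [C hC <-] := Scode_attained n rk.
have q_gt0 (i : 'I_N) : 0 < q by case: q Nqn => // NO; case: i => i /leq_trans/(_ NO).
have fP (i : 'I_N) : i %/ q < n.
  by rewrite ltn_divLR ?(q_gt0 i)// mulnC (leq_trans (ltn_ord i)).
pose f i := Ordinal (fP i); pose g (i : 'I_N) := Ordinal (ltn_pmod i (q_gt0 i)).
pose D := [set x : r.-tuple 'I_N | map_tuple f x \in C].
have hD : covering_insertion_code k D.
  apply/forallP => a; apply/existsP.
  have /forallP/(_ (map_tuple f a))/existsP[y /andP[yC /subseqP[m szm ym]]] := hC.
  have sz : size (mask m a) == r.
    by rewrite -(size_map f) map_mask -ym size_tuple.
  exists (Tuple sz); rewrite inE /covers mask_subseq andbT.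
  suff -> : map_tuple f (Tuple sz) = y by [].
  by apply: val_inj; rewrite /= map_mask ym.
apply: leq_trans (Scode_min rk hD) _.
pose h (x : r.-tuple 'I_N) := (map_tuple g x, map_tuple f x).
have h_inj : injective h.
  move=> x y [] /(congr1 (map val)) + /(congr1 (map val)).
  rewrite -!map_comp => gE fE; apply: eq_from_tnth => i; apply: val_inj => /=.
  have i_lt (z : r.-tuple 'I_N) : i < size z by rewrite size_tuple.
  have := congr1 (fun s => nth 0 s i) gE; have := congr1 (fun s => nth 0 s i) fE.
  rewrite !(nth_map (tnth x i))// -!tnth_nth /= => fi gi.
  by rewrite (divn_eq (tnth x i) q) (divn_eq (tnth y i) q) fi gi.
rewrite -(card_imset _ h_inj) -[q in q ^ r]card_ord -card_tuple -cardsT -cardsX.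
apply/subset_leq_card/subsetP => _ /imsetP[x xD ->].
by move: xD; rewrite !inE.
Qed.

From mathcomp Require Import all_classical all_reals all_analysis.
Import Order.TTheory GRing.Theory Num.Theory.
Import numFieldNormedType.Exports.

Local Open Scope classical_set_scope.
Local Open Scope ring_scope.

(* [s(k, r)]. The limit exists when [r <= k] (lemma [is_cvg_scode]). *)
Definition scode (R : realType) (k r : nat) : R :=
  lim (((Scode n k r)%:R / n%:R ^+ r : R) @[n --> \oo]).

Lemma is_cvg_scode (R : realType) (k r : nat) : (r <= k)%N ->
  cvg (((Scode n k r)%:R / n%:R ^+ r : R) @[n --> \oo]).
Proof.
move=> rk; pose u n : R := (Scode n k r)%:R / n%:R ^+ r.
pose A := [set u n.+1 | n in setT]; pose l := inf A.
have u_ge0 n : 0 <= u n by rewrite divr_ge0// exprn_ge0.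
have hA : has_inf A.
  by split; [exists (u 1%N), 0%N | exists 0 => _ [n _ <-]].
have u_blow m N : u N.+1 <= u m.+1 * (1 + m.+1%:R * N.+1%:R^-1) ^+ r.
  pose q := (N.+1 %/ m.+1).+1.
  have Nq : (N.+1 <= q * m.+1)%N by apply: ltnW; rewrite ltn_ceil.
  have := Scode_blowup rk Nq; rewrite -(ler_nat R) natrM natrX => H.
  rewrite /u ler_pdivrMr ?exprn_gt0//; apply: le_trans H _.
  rewrite mulrC -!mulrA ler_wpM2l// -exprVn -!exprMn.
  rewrite lerXn2r ?nnegrE ?mulr_ge0 ?addr_ge0 ?mulr_ge0 ?invr_ge0//.
  rewrite mulrDl mul1r mulfVK ?pnatr_eq0// mulrC ler_pdivlMr//.
  by rewrite -natrM -natrD ler_nat /q mulSn addnC leq_add2r leq_trunc_div.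
suff : u n @[n --> \oo] --> l by move/cvgP.
rewrite -(cvg_shiftS u); apply/cvgrPdist_lt => e e0.
have [_ [m _ <-] um] := inf_adherent e0 hA.
have cv : u m.+1 * (1 + m.+1%:R * N.+1%:R^-1) ^+ r @[N --> \oo] --> u m.+1.
  rewrite [X in _ --> X](_ : _ = u m.+1 * (1 + m.+1%:R * 0) ^+ r); last first.
    by rewrite mulr0 addr0 expr1n mulr1.
  apply: cvgM; first exact: cvg_cst.
  have c1 : 1 + m.+1%:R * N.+1%:R^-1 @[N --> \oo] --> (1 + m.+1%:R * 0 : R).
    apply: cvgD; first exact: cvg_cst.
    by apply: cvgM; [exact: cvg_cst|exact: cvg_harmonic].
  exact: (cvg_comp _ _ c1 (@exprn_continuous R r _)).
have : \forall N \near \oo, u m.+1 * (1 + m.+1%:R * N.+1%:R^-1) ^+ r < l + e.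
  by apply: cvgr_lt cv _ um.
apply: filterS => N hN.
have lN : l <= u N.+1 by apply: (ge_inf hA.2); exists N.
rewrite distrC ger0_norm ?subr_ge0// ltrBlDl.
exact: le_lt_trans (u_blow m N) hN.
Qed.

(* Main.v *)
Require Import Defs.
From mathcomp Require Import all_boot all_order all_algebra.
From mathcomp Require Import all_classical all_reals all_analysis.
From mathcomp Require Import zify ring lra.

Import Order.TTheory GRing.Theory Num.Theory.
Import numFieldNormedType.Exports.

(** Write s_r for [scode R r.+1 r].  Everything follows from one recursive
inequality: for 1 <= m <= r and 0 <= d <= 1,
  s_r <= d + (1 - d)^m s_(r-m).
Take a random set S of words of length m - 1 over an alphabet of n letters, each
word being chosen independently with probability d.  A word u of length m with
distinct letters has m distinct one-letter deletions, so all of them avoid S with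
probability (1 - d)^m; words with a repeated letter have density O(1/n) and vanish
in the limit.  Let T be the set of the words u whose deletions all avoid S, and
let G be an optimal code for the words of length r - m + 1.  The code of the words
of length r whose prefix of length m - 1 is in S, or whose prefix of length m is
in T with the rest in G, covers every word of length r + 1: cut it as u v with u
of length m; if u is not in T, delete a letter of u so as to land in S, and
otherwise delete a letter of v so as to land in G.  Averaging over S gives the
inequality at each finite alphabet size ([Scode_step]), and the limit gives
[scode_step].

With d = c / m one gets s_r <= c / m + exp(-c) s_(r-m).  If m is about
beta (r + 1), then f(r) = (r + 1) s_r satisfies
  f(r) <= c / beta + exp(-c) / (1 - beta) f(r - m),
whose fixed point is (c / beta) / (1 - exp(-c) / (1 - beta)).  At c = 5/2 and
beta = 5/7, which are close to optimal, this is about 4.91089.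

The uniform bound is a strong induction with c = 5/2 and m close to
(r + 1) / 2; the asymptotic one iterates the recursion with beta = 5/7 from that
uniform bound until the value drops below 4.911. *)

Local Open Scope ring_scope.

(** * Averaging over a random set *)

(** The probability of [S] when each element of [T] is chosen independently with
probability [d]. *)
Definition set_weight {R : realDomainType} {T : finType} (d : R)
    (S : {set T}) : R :=
  \prod_x (if x \in S then d else 1 - d).

Lemma set_weight_ge0 {R : realDomainType} {T : finType} (d : R) (S : {set T}) :
  0 <= d -> d <= 1 -> 0 <= set_weight d S.
Proof. by move=> d0 d1; apply: prodr_ge0 => x _; case: ifP; rewrite ?subr_ge0. Qed.

Lemma set_weight_disjoint {R : realDomainType} {T : finType} (d : R)
    (W : {set T}) :
  \sum_(S : {set T}) set_weight d S * [disjoint W & S]%:R = (1 - d) ^+ #|W|.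
Proof.
(* Dropping the choice of the elements of W turns the total weight d + (1 - d)
   of each of them into 1 - d. *)
have -> : (1 - d) ^+ #|W| = \prod_x ((x \notin W)%:R * d + (1 - d)).
  rewrite (bigID [in W])/= [X in _ * X]big1 ?mulr1.
    rewrite -prodr_const; apply: eq_bigr => x ->.
    by rewrite mul0r add0r.
  by move=> x ->; rewrite mul1r addrC subrK.
rewrite bigA_distr; apply: eq_bigr => S _.
have [dWS|] := boolP [disjoint W & S].
  rewrite mulr1; apply: eq_bigr => x _; case: ifP => // xS.
  by rewrite (disjointFl dWS xS) mul1r.
rewrite -finset.setI_eq0 => /finset.set0Pn[x]; rewrite inE => /andP[xW xS].
by rewrite mulr0 (bigD1 x)//= xS xW /= mul0r mul0r.
Qed.

Lemma set_weight_sum {R : realDomainType} {T : finType} (d : R) :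
  \sum_(S : {set T}) set_weight d S = 1.
Proof.
rewrite -[RHS](expr0 (1 - d)) -(cards0 T) -set_weight_disjoint.
by apply: eq_bigr => S _; rewrite finset.disjoints_subset finset.sub0set mulr1.
Qed.

Lemma set_weight_card {R : realDomainType} {T : finType} (d : R) :
  \sum_(S : {set T}) set_weight d S * #|S|%:R = d * #|T|%:R.
Proof.
have cardE (S : {set T}) :
    #|S|%:R = \sum_x (1 - [disjoint [set x] & S]%:R) :> R.
  rewrite -sum1_card natr_sum big_mkcond; apply: eq_bigr => x _.
  by rewrite disjoints1; case: (x \in S); rewrite ?subr0 ?subrr.
under eq_bigr => S _ do rewrite cardE mulr_sumr.
rewrite exchange_big/= mulr_natr -sumr_const; apply: eq_bigr => x _.
under eq_bigr => S _ do rewrite mulrBr mulr1.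
by rewrite sumrB set_weight_sum set_weight_disjoint cards1 expr1 opprB addrC subrK.
Qed.

(** Some set does at least as well as a random one for the cost that charges [a]
for each of its elements and [b] for each [W i] that it misses. *)
Lemma exists_sparse_hitting_set {R : realDomainType} {T I : finType}
    (d : R) (W : I -> {set T}) (a b : R) : 0 <= d -> d <= 1 ->
  exists S : {set T},
    #|S|%:R * a + #|[set i | [disjoint W i & S]]|%:R * b <=
    d * #|T|%:R * a + (\sum_i (1 - d) ^+ #|W i|) * b.
Proof.
move=> d0 d1; pose X (S : {set T}) : R :=
  #|S|%:R * a + #|[set i | [disjoint W i & S]]|%:R * b.
case: (@arg_minP _ _ _ (finset.set0 : {set T}) predT X) => // S _ SX.
exists S.
have -> : #|S|%:R * a + #|[set i | [disjoint W i & S]]|%:R * b =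
    \sum_(S' : {set T}) set_weight d S' * X S.
  by rewrite -mulr_suml set_weight_sum mul1r.
have -> : d * #|T|%:R * a + (\sum_i (1 - d) ^+ #|W i|) * b =
    \sum_(S : {set T}) set_weight d S * X S.
  under [RHS]eq_bigr => S' _ do rewrite mulrDr !mulrA.
  rewrite big_split/= -!mulr_suml set_weight_card; congr (_ + _ * _).
  under eq_bigr => i _ do rewrite -set_weight_disjoint.
  rewrite exchange_big/=; apply: eq_bigr => S' _; rewrite -mulr_sumr; congr (_ * _).
  rewrite -sum1_card natr_sum [RHS]big_mkcond; apply: eq_bigr => i _.
  by rewrite inE; case: [disjoint _ & _].
by apply: ler_sum => S' _; rewrite ler_wpM2l ?set_weight_ge0 ?SX.
Qed.

(** * One-letter deletions of a word *)

(** The words obtained from [u] by removing one letter, that is, the subsequences of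
[u] with one letter fewer. *)
Definition one_deletions {X : finType} {k : nat} (u : k.+1.-tuple X) :
  {set k.-tuple X} := [set s : k.-tuple X | subseq s u].

Lemma card_one_deletions {X : finType} {k : nat} (u : k.+1.-tuple X) :
  uniq u -> (k.+1 <= #|one_deletions u|)%N.
Proof.
(* Removing distinct letters gives distinct words.  [rem x u] has length k as soon
   as x occurs in u, so the default value of [insubd] is never met. *)
move=> uu; pose f (x : X) : k.-tuple X := insubd (nseq_tuple k x) (rem x u).
have fE x : x \in u -> f x = rem x u :> seq X.
  by move=> xu; rewrite val_insubd size_rem// size_tuple eqxx.
have finj : {in [set x in u] &, injective f}.
  move=> x y; rewrite !inE => xu yu /(congr1 val)/=; rewrite !fE// => e.
  apply/eqP/negPn/negP => xy.
  have : y \in rem x u by rewrite mem_rem_uniq// !inE eq_sym xy.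
  by rewrite e mem_rem_uniq// !inE eqxx.
have <- : #|[set x in u]| = k.+1 by rewrite cardsE (card_uniqP uu) size_tuple.
rewrite -(card_in_imset finj).
apply/subset_leq_card/fintype.subsetP => _ /imsetP[x xu ->].
by move: xu; rewrite !inE => xu; rewrite fE// rem_subseq.
Qed.

Lemma expn_sub_ffact (n m : nat) : (n ^ m - n ^_ m <= m ^ 2 * n ^ m.-1)%N.
Proof.
suff : (n ^ m <= n ^_ m + m ^ 2 * n ^ m.-1)%N by lia.
elim: m => [|m IH]; first by rewrite ffactn0.
rewrite expnS ffactnSr /=.
have h : (n * n ^ m <= n * n ^_ m + m ^ 2 * n ^ m)%N.
  apply: leq_trans (leq_mul (leqnn n) IH) _; rewrite mulnDr leq_add2l.
  by rewrite mulnCA; case: m {IH} => [|m]; rewrite ?exp0n ?mul0n //= -expnS.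
have h2 : (n ^_ m <= n ^ m)%N.
  by elim: (m) => // p; rewrite ffactnSr expnSr => ?; rewrite leq_mul// leq_subr.
have h3 : (n * n ^_ m <= n ^_ m * (n - m) + m * n ^_ m)%N by nia.
nia.
Qed.

Lemma card_non_uniq_tuples (X : finType) (m : nat) :
  (#|[set u : m.-tuple X | ~~ uniq u]| <= m ^ 2 * #|X| ^ m.-1)%N.
Proof.
apply: leq_trans (expn_sub_ffact _ _).
rewrite -card_uniq_tuples -card_tuple.
rewrite -(finset.cardsC [set u : m.-tuple X | all predT u & uniq u]).
rewrite addKn; apply/subset_leq_card/fintype.subsetP => u.
by rewrite !inE all_predT.
Qed.

(** The expected number of words of length [k.+1] whose deletions all avoid a random
set of density [d]; the second term bounds the contribution of the words with a
repeated letter. *)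
Lemma sum_one_deletions {R : realDomainType} (d : R) (X : finType) (k : nat) :
  0 <= d -> d <= 1 ->
  \sum_(u : k.+1.-tuple X) (1 - d) ^+ #|one_deletions u| <=
  #|X|%:R ^+ k.+1 * (1 - d) ^+ k.+1 + k.+1%:R ^+ 2 * #|X|%:R ^+ k.
Proof.
move=> d0 d1; have e0 : 0 <= 1 - d by rewrite subr_ge0.
have e1 : 1 - d <= 1 by rewrite gerBl.
rewrite (bigID (fun u : k.+1.-tuple X => uniq u))/= lerD//.
  apply: (@le_trans _ _ (\sum_(u : k.+1.-tuple X | uniq u) (1 - d) ^+ k.+1)).
    by apply: ler_sum => u /card_one_deletions ?; rewrite ler_wiXn2l.
  rewrite sumr_const -natrX -card_tuple -[leLHS]mulr_natl.
  by rewrite ler_wpM2r ?exprn_ge0// ler_nat max_card.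
apply: (@le_trans _ _ (\sum_(u : k.+1.-tuple X | ~~ uniq u) 1)).
  by apply: ler_sum => u _; rewrite exprn_ile1.
rewrite sumr_const -!natrX -natrM ler_nat.
by apply: leq_trans (card_non_uniq_tuples X k.+1); rewrite cardsE.
Qed.

(** * The recursive construction *)

Lemma Scode_step {R : realDomainType} (n k j : nat) (d : R) :
  0 <= d -> d <= 1 ->
  (Scode n (k + j.+1).+1 (k + j.+1))%:R <=
  d * n%:R ^+ k * n%:R ^+ j.+1 +
  (n%:R ^+ k.+1 * (1 - d) ^+ k.+1 + k.+1%:R ^+ 2 * n%:R ^+ k) *
  (Scode n j.+1 j)%:R.
Proof.
move=> d0 d1.
have [G hG <-] := Scode_attained n (leqnSn j).
have [S hS] := exists_sparse_hitting_set d (@one_deletions 'I_n k)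
  (n%:R ^+ j.+1) #|G|%:R d0 d1.
set T := [set u | _] in hS.
pose f (p : k.-tuple 'I_n * j.+1.-tuple 'I_n) : (k + j.+1).-tuple 'I_n :=
  [tuple of p.1 ++ p.2].
pose g (p : k.+1.-tuple 'I_n * j.-tuple 'I_n) : (k + j.+1).-tuple 'I_n :=
  tcast (addSnnS k j) [tuple of p.1 ++ p.2].
pose C := f @: finset.setX S [set: _] :|: g @: finset.setX T G.
have hC : covering_insertion_code (k + j.+1).+1 C.
  apply/forallP => a; apply/existsP.
  have su : size (take k.+1 a) == k.+1.
    by rewrite size_take_min size_tuple; apply/eqP; lia.
  have sv : size (drop k.+1 a) == j.+1.
    by rewrite size_drop size_tuple; apply/eqP; lia.
  (* If no deletion of the prefix of length k+1 is in S, delete from the rest. *)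
  have [uT|] := boolP (Tuple su \in T).
    have /forallP/(_ (Tuple sv))/existsP[y /andP[yG yv]] := hG.
    exists (g (Tuple su, y)); apply/andP; split.
      by rewrite finset.in_setU orbC imset_f// finset.in_setX uT.
    rewrite /covers val_tcast /= -[in X in subseq _ X](cat_take_drop k.+1 a).
    by rewrite cat_subseq.
  rewrite inE -finset.setI_eq0 => /finset.set0Pn[s]; rewrite !inE => /andP[su' sS].
  exists (f (s, Tuple sv)); apply/andP; split.
    by rewrite finset.in_setU imset_f// finset.in_setX sS inE.
  rewrite /covers /= -[in X in subseq _ X](cat_take_drop k.+1 a).
  by rewrite cat_subseq.
have Cle : (#|C| <= #|S| * n ^ j.+1 + #|T| * #|G|)%N.
  apply: leq_trans (leq_card_setU _ _) _; apply: leq_add.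
    apply: leq_trans (leq_imset_card _ _) _.
    by rewrite cardsX finset.cardsT card_tuple card_ord.
  by apply: leq_trans (leq_imset_card _ _) _; rewrite cardsX.
have := leq_trans (Scode_min (leqnSn _) hC) Cle.
rewrite -(ler_nat R) natrD !natrM natrX => /le_trans; apply.
apply: le_trans hS _; rewrite card_tuple card_ord natrX lerD2l ler_wpM2r//.
by have := @sum_one_deletions R d 'I_n k d0 d1; rewrite card_ord.
Qed.

(** * Passing to the limit *)

Local Open Scope classical_set_scope.
Local Open Scope ring_scope.

Lemma scode_le1 (R : realType) (r : nat) : scode R r.+1 r <= 1.
Proof.
apply: limr_le; first exact: is_cvg_scode.
apply: nearW => n; rewrite -natrX.
have le : (Scode n r.+1 r <= n ^ r)%N.
  apply: leq_trans (Scode_min (leqnSn r) (covering_setT _ (leqnSn r))) _.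
  by rewrite finset.cardsT card_tuple card_ord.
have [->|n0] := posnP (n ^ r)%N; first by rewrite invr0 mulr0.
by rewrite ler_pdivrMr ?ltr0n// mul1r ler_nat.
Qed.

Lemma scode_ge0 (R : realType) (r : nat) : 0 <= scode R r.+1 r.
Proof.
apply: limr_ge; first exact: is_cvg_scode.
by apply: nearW => n; rewrite divr_ge0 ?exprn_ge0.
Qed.

(** The recursive inequality, with m = k + 1 and r - m = j. *)
Lemma scode_step (R : realType) (k j : nat) (d : R) : 0 <= d -> d <= 1 ->
  scode R (k + j.+1).+1 (k + j.+1) <= d + (1 - d) ^+ k.+1 * scode R j.+1 j.
Proof.
move=> d0 d1.
have cvS r : ((Scode n.+1 r.+1 r)%:R / n.+1%:R ^+ r : R) @[n --> \oo]
    --> scode R r.+1 r.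
  pose u n : R := (Scode n r.+1 r)%:R / n%:R ^+ r.
  have : u n @[n --> \oo] --> scode R r.+1 r by exact: is_cvg_scode.
  by rewrite -(cvg_shiftS u).
(* The repeated letters contribute an error of order 1/n. *)
have cvg_err : (d + ((1 - d) ^+ k.+1 + k.+1%:R ^+ 2 * n.+1%:R^-1) *
      ((Scode n.+1 j.+1 j)%:R / n.+1%:R ^+ j) : R) @[n --> \oo]
    --> d + ((1 - d) ^+ k.+1 + k.+1%:R ^+ 2 * 0) * scode R j.+1 j.
  apply: cvgD; first exact: cvg_cst.
  apply: cvgM; last exact: cvS.
  apply: cvgD; first exact: cvg_cst.
  by apply: cvgM; [exact: cvg_cst|exact: cvg_harmonic].
rewrite mulr0 addr0 in cvg_err.
apply: ler_cvg_to (cvS _) cvg_err _.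
apply: nearW => n; rewrite ler_pdivrMr ?exprn_gt0//.
apply: le_trans (Scode_step n.+1 k j d d0 d1) _.
rewrite le_eqVlt; apply/orP; left; apply/eqP.
have n0 : n.+1%:R != 0 :> R by rewrite pnatr_eq0.
rewrite exprD !exprS.
by field; rewrite nat1r expf_neq0 ?n0.
Qed.

Lemma scode_expR_step (R : realType) (c : R) (m r : nat) :
  0 <= c -> c <= m%:R -> (0 < m)%N -> (m <= r)%N ->
  scode R r.+1 r <= c / m%:R + expR (- c) * scode R (r - m).+1 (r - m).
Proof.
move=> c0 cm m0 mr.
have m0' : 0 < m%:R :> R by rewrite ltr0n.
have d0 : 0 <= c / m%:R by rewrite divr_ge0// ltW.
have d1 : c / m%:R <= 1 by rewrite ler_pdivrMr// mul1r.
have := scode_step R m.-1 (r - m) (c / m%:R) d0 d1.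
rewrite (_ : (m.-1 + (r - m).+1 = r)%N); last lia.
rewrite prednK// => /le_trans; apply; rewrite lerD2l ler_wpM2r ?scode_ge0//.
have -> : expR (- c) = expR (- (c / m%:R)) ^+ m.
  by rewrite -expRM_natl mulrN mulrC divfK// gt_eqF.
by rewrite lerXn2r ?nnegrE ?subr_ge0 ?expR_ge0// expR_ge1Dx.
Qed.

(** * Numerical form of the recursion *)

Lemma exp_coeffS (R : realType) (x : R) (n : nat) :
  exp_coeff x n.+1 = exp_coeff x n * (x / n.+1%:R).
Proof. by rewrite !exp_coeffE /= factS natrM invfM exprSr; ring. Qed.

Lemma expRN5_2 (R : realType) : expR (- (5 / 2)) <= 137 / 1669 :> R.
Proof.
(* The partial sum of 14 terms of exp(5/2) already exceeds 1669/137. *)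
rewrite expRN -[leRHS]invrK.
rewrite lef_pV2 ?posrE ?expR_gt0 ?invr_gt0 ?divr_gt0 ?ltr0n//.
have x0 : 0 <= 5 / 2 :> R by lra.
have homo : {homo series (exp_coeff (5 / 2 : R)) : n m / (n <= m)%N >-> n <= m}.
  by apply: nondecreasing_series => n _ _; exact: exp_coeff_ge0.
apply: le_trans (nondecreasing_cvgn_le homo (is_cvg_series_exp_coeff _) 14).
rewrite /series /= big_mkord !big_ord_recr big_ord0 /=.
have e0 : exp_coeff (5 / 2 : R) 0 = 1 by rewrite exp_coeffE expr0 mulr1 invr1.
rewrite !exp_coeffS e0.
lra.
Qed.

Lemma scode_step5_2 (R : realType) (m r : nat) : (3 <= m)%N -> (m <= r)%N ->
  scode R r.+1 r <=
  5 / 2 / m%:R + 137 / 1669 * scode R (r - m).+1 (r - m).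
Proof.
move=> m3 mr.
have c0 : 0 <= 5 / 2 :> R by lra.
have cm : 5 / 2 <= m%:R :> R.
  by apply: (@le_trans _ _ 3%:R); [lra|rewrite ler_nat].
apply: le_trans (scode_expR_step _ _ m r c0 cm _ mr) _; first lia.
by rewrite lerD2l ler_wpM2r ?scode_ge0 ?expRN5_2.
Qed.

(** * The two bounds *)

(** The trivial bound s_r <= 1 settles r <= 5 for any constant A >= 6, and the
induction step needs 5 + 137/1669 * 7/3 * A <= A; 31/5 satisfies both. *)
Lemma scode_le_uniform (R : realType) (r : nat) :
  scode R r.+1 r <= 31 / 5 / r.+1%:R.
Proof.
elim/ltn_ind: r => r IH.
have [r5|r6] := leqP r 5.
  apply: le_trans (scode_le1 R r) _.
  rewrite ler_pdivlMr ?ltr0n// mul1r.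
  by apply: (@le_trans _ _ 6%:R); [rewrite ler_nat|lra].
(* With m = ceil((r + 1) / 2) the first term of the recursion is at most
   5 / (r + 1); since r >= 6, r + 1 - m is at least 3/7 of r + 1, and
   137/1669 * 7/3 * 31/5 < 6/5 = 31/5 - 5. *)
pose m := uphalf r.+1.
have m3 : (3 <= m)%N by rewrite /m; lia.
have mr : (m <= r)%N by rewrite /m; lia.
apply: le_trans (scode_step5_2 R m r m3 mr) _.
have /IH IHr : (r - m < r)%N by lia.
have m0 : 0 < m%:R :> R by rewrite ltr0n; lia.
have n0 : 0 < r.+1%:R :> R by rewrite ltr0n.
have q0 : 0 < (r - m).+1%:R :> R by rewrite ltr0n.
have t1 : 5 / 2 / m%:R <= 5 / r.+1%:R :> R.
  rewrite ler_pdivrMr// mulrAC ler_pdivlMr//.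
  have : r.+1%:R <= 2 * m%:R :> R by rewrite -natrM ler_nat /m; lia.
  lra.
have t2 : (31 / 5) / (r - m).+1%:R <= (7 / 3 * (31 / 5)) / r.+1%:R :> R.
  rewrite ler_pdivrMr// mulrAC ler_pdivlMr//.
  have : 3 * r.+1%:R <= 7 * (r - m).+1%:R :> R by rewrite -!natrM ler_nat /m; lia.
  lra.
have -> : 31 / 5 / r.+1%:R = 5 / r.+1%:R + 6 / 5 / r.+1%:R :> R.
  by rewrite -mulrDl; congr (_ / _); lra.
apply: lerD t1 _.
apply: le_trans (ler_wpM2l _ (le_trans IHr t2)) _; first lra.
by rewrite [leLHS]mulrA ler_pM2r ?invr_gt0//; lra.
Qed.

(** A rational slightly above 7/2 * 137/1669, the limiting contraction factor of the
recursion for beta = 5/7; the excess absorbs the rounding of m, and the fixed point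
3143/640 of B |-> 7/2 + asymptotic_ratio * B still lies below 4.911. *)
Definition asymptotic_ratio {R : realType} : R := 129 / 449.

(** One round of the recursion: an eventual bound [B] on (r + 1) s_r improves to
7/2 + [asymptotic_ratio] * [B]. *)
Lemma scode_iterate (R : realType) (B : R) : 0 <= B ->
  (exists N, forall r, (N <= r)%N -> r.+1%:R * scode R r.+1 r <= B) ->
  exists N, forall r, (N <= r)%N ->
    r.+1%:R * scode R r.+1 r <= 7 / 2 + asymptotic_ratio * B.
Proof.
move=> B0 [N hN].
(* The excess of the ratio covers the rounding once r exceeds about 137010. *)
have [K _ hK] := nbhs_infty_ger (10 ^+ 6 : R).
exists (maxn (maxn 8 K) (7 * N + 7)) => r.
rewrite !geq_max -andbA => /and3P[r8 Kr Nr].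
have {hK Kr} rbig : 10 ^+ 6 <= r.+1%:R :> R by apply: hK; rewrite /=; lia.
pose m := ((5 * r.+1) %/ 7).+1.
have m3 : (3 <= m)%N by rewrite /m; lia.
have mr : (m <= r)%N by rewrite /m; lia.
have /hN hq : (N <= r - m)%N by rewrite /m; lia.
have := scode_step5_2 R m r m3 mr.
have m0 : 0 < m%:R :> R by rewrite ltr0n; lia.
have n0 : 0 < r.+1%:R :> R by rewrite ltr0n.
have q0 : 0 < (r - m).+1%:R :> R by rewrite ltr0n.
rewrite -(ler_pM2l n0) => /le_trans; apply; rewrite mulrDr; apply: lerD.
  rewrite mulrA ler_pdivrMr//.
  have : 5 * r.+1%:R <= 7 * m%:R :> R by rewrite -!natrM ler_nat /m; lia.
  lra.
have qn : 2 * r.+1%:R - 7 <= 7 * (r - m).+1%:R :> R.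
  by rewrite lerBlDr -!natrM -natrD ler_nat /m; lia.
have hn : 137 / 1669 * r.+1%:R <= asymptotic_ratio * (r - m).+1%:R :> R.
  by rewrite /asymptotic_ratio; lra.
rewrite mulrCA mulrA.
apply: le_trans (ler_wpM2r (scode_ge0 _ _) hn) _.
by rewrite -mulrA ler_wpM2l// /asymptotic_ratio; lra.
Qed.

Lemma scode_iterates (R : realType) (i : nat) :
  exists N, forall r, (N <= r)%N -> r.+1%:R * scode R r.+1 r <=
    3143 / 640 + asymptotic_ratio ^+ i * 7.
Proof.
elim: i => [|i IH].
  exists 0 => r _; have := scode_le_uniform R r; rewrite ler_pdivlMr ?ltr0n// mulrC.
  move=> /le_trans; apply; rewrite expr0 /asymptotic_ratio; lra.
have /scode_iterate : 0 <= 3143 / 640 + asymptotic_ratio ^+ i * 7 :> R.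
  have t0 : 0 <= asymptotic_ratio :> R by rewrite /asymptotic_ratio; lra.
  apply: addr_ge0; first lra.
  by apply: mulr_ge0; [exact: exprn_ge0|lra].
move=> /(_ IH)[N hN]; exists N => r /hN /le_trans; apply.
rewrite le_eqVlt; apply/orP; left; apply/eqP; rewrite exprS.
by move: (asymptotic_ratio ^+ i) => x; rewrite /asymptotic_ratio; lra.
Qed.

Theorem corollary13 (R : realType) :
  (forall r : nat, (0 < r)%N ->
     scode R r.+1 r <= (6239%:R / 1000%:R) / r.+1%:R) /\
  (\forall r \near \oo, scode R r.+1 r <= (4911%:R / 1000%:R) / r.+1%:R).
Proof.
split=> [r _|].
  apply: le_trans (scode_le_uniform R r) _.
  by rewrite ler_pM2r ?invr_gt0 ?ltr0n//; lra.
(* 3143/640 = 4.9109375 and 7 * (129/449)^12 < 10^-5. *)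
have [N hN] := scode_iterates R 12.
exists N => // r /= /hN; rewrite ler_pdivlMr ?ltr0n// [leLHS]mulrC.
move=> /le_trans; apply.
rewrite /asymptotic_ratio; lra.
Qed.
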